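(* There exists an arithmetic coinfinite set $A\subseteq\mathbb N$ such that $\mathsf{id}\not\leq E_A^+$.
   Context: For $A\subseteq\mathbb N$, $E_A$ is the equivalence relation on $\mathbb N$ with $m\mathrel{E_A}n$ iff $m=n$ or $m,n\in A$. $\mathsf{id}$ is the identity relation on $\mathbb N$. $\phi_e$ is the $e$-th partial computable function. The computable FS-jump is $E^+$ on $\mathbb N$ with $e\mathrel{E^+}e'$ iff $\{[\phi_e(n)]_E:\phi_e(n)\downarrow\}=\{[\phi_{e'}(n)]_E:\phi_{e'}(n)\downarrow\}$. $E\leq F$ means there is a total computable $f$ with $x\mathrel{E}y\iff f(x)\mathrel{F}f(y)$. *)

(* Defs.v *)
From Stdlib Require Import Arith Cantor Lia Ensembles Finite_sets.

(** * Partial computable functions *)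

Notation "<< x , y >>" := (Cantor.to_nat (x, y)) (at level 0).

(** Programs for the Kleene partial recursive functions, presented as functions
    of one natural number; several arguments are passed through the Cantor
    pairing bijection.  [left] and [right] are its two projections. *)
Inductive code : Type :=
| czero
| csucc
| cleft
| cright
| cpair (f g : code)
| ccomp (f g : code)
| cprec (f g : code)
| cmu (f : code).

Fixpoint primrec_graph (F G : nat -> nat -> Prop) (a n y : nat) : Prop :=
  match n with
  | 0 => F a y
  | S m => exists z, primrec_graph F G a m z /\ G <<a, <<m, z>>>> y
  end.

(** [eval c x y]: the program [c] halts on input [x] with output [y].
    - [cprec f g] on [<<a, n>>] is [h a n], where [h a 0 = f a] and
      [h a (m + 1) = g <<a, <<m, h a m>>>>];
    - [cmu f] on [x] is the least [y] with [f <<x, y>> = 0], provided that [f]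
      is defined at [<<x, z>>] for all [z < y]. *)
Fixpoint eval (c : code) (x y : nat) : Prop :=
  match c with
  | czero => y = 0
  | csucc => y = S x
  | cleft => y = fst (Cantor.of_nat x)
  | cright => y = snd (Cantor.of_nat x)
  | cpair f g => exists a b, eval f x a /\ eval g x b /\ y = <<a, b>>
  | ccomp f g => exists z, eval g x z /\ eval f z y
  | cprec f g =>
      let (a, n) := Cantor.of_nat x in primrec_graph (eval f) (eval g) a n y
  | cmu f =>
      eval f <<x, y>> 0 /\ forall z, z < y -> exists k, eval f <<x, z>> (S k)
  end.

(** The Goedel number of a program. *)
Fixpoint encode (c : code) : nat :=
  match c with
  | czero => 0
  | csucc => 1
  | cleft => 2
  | cright => 3
  | cpair f g => 4 + 4 * <<encode f, encode g>>
  | ccomp f g => 5 + 4 * <<encode f, encode g>>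
  | cprec f g => 6 + 4 * <<encode f, encode g>>
  | cmu f => 7 + 4 * encode f
  end.

(** [phi e x y]: the [e]-th partial computable function converges at [x] with
    value [y].  By [encode_inj], [encode_surj] and [eval_fun] below, [e] is the
    number of exactly one program and [phi e] is the graph of a partial
    function. *)
Definition phi (e x y : nat) : Prop := exists c, encode c = e /\ eval c x y.

Definition computable (f : nat -> nat) : Prop :=
  exists e, forall x, phi e x (f x).

Lemma eval_fun c x y y' : eval c x y -> eval c x y' -> y = y'.
Proof.
  revert x y y'.
  induction c as [ | | | | f IHf g IHg | f IHf g IHg | f IHf g IHg | f IHf];
    simpl; intros x y y'; try congruence.
  - intros (a & b & Ha & Hb & ->) (a' & b' & Ha' & Hb' & ->).
    now rewrite (IHf _ _ _ Ha Ha'), (IHg _ _ _ Hb Hb').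
  - intros (z & Hz & Hy) (z' & Hz' & Hy').
    rewrite <- (IHg _ _ _ Hz Hz') in Hy'. eauto.
  - destruct (Cantor.of_nat x) as [a n]. revert y y'.
    induction n as [|n IHn]; simpl; intros y y'; [eauto|].
    intros (z & Hz & Hy) (z' & Hz' & Hy').
    rewrite <- (IHn _ _ Hz Hz') in Hy'. eauto.
  - intros [H L] [H' L'].
    destruct (Nat.lt_trichotomy y y') as [h | [h | h]]; [ | exact h | ].
    + destruct (L' _ h) as [k Hk]. discriminate (IHf _ _ _ H Hk).
    + destruct (L _ h) as [k Hk]. discriminate (IHf _ _ _ H' Hk).
Qed.

Lemma encode_inj c d : encode c = encode d -> c = d.
Proof.
  assert (P : forall a b a' b', <<a, b>> = <<a', b'>> -> a = a' /\ b = b').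
  { intros a b a' b' H. apply Cantor.to_nat_inj in H. now inversion H. }
  revert d.
  induction c as [ | | | | f IHf g IHg | f IHf g IHg | f IHf g IHg | f IHf];
    intros [ | | | | f' g' | f' g' | f' g' | f']; cbn [encode]; intros H;
    try reflexivity; try (exfalso; lia).
  1-3: destruct (P (encode f) (encode g) (encode f') (encode g')) as [Hf Hg];
    [lia | now rewrite (IHf _ Hf), (IHg _ Hg)].
  rewrite (IHf f'); [reflexivity | lia].
Qed.

Lemma encode_surj e : exists c, encode c = e.
Proof.
  induction e as [e IH] using lt_wf_ind.
  destruct (Nat.lt_ge_cases e 4) as [h | h].
  - destruct e as [|[|[|[|e]]]]; [now exists czero | now exists csucc
      | now exists cleft | now exists cright | lia].
  - pose (q := (e - 4) / 4). pose (r := (e - 4) mod 4).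
    assert (D : e - 4 = 4 * q + r) by (apply Nat.div_mod; lia).
    assert (r < 4) by (apply Nat.mod_upper_bound; lia).
    destruct (Cantor.of_nat q) as [a b] eqn:Q.
    assert (Q' : <<a, b>> = q) by now rewrite <- Q, Cantor.cancel_to_of.
    pose proof (Cantor.to_nat_non_decreasing a b).
    destruct (IH a) as [f Hf]; [lia |].
    destruct (IH b) as [g Hg]; [lia |].
    destruct (IH q) as [k Hk]; [lia |].
    assert (r = 0 \/ r = 1 \/ r = 2 \/ r = 3) as [R | [R | [R | R]]] by lia;
      [exists (cpair f g) | exists (ccomp f g) | exists (cprec f g)
      | exists (cmu k)]; cbn [encode]; rewrite ?Hf, ?Hg, ?Hk, ?Q'; lia.
Qed.

(** * The arithmetical hierarchy *)

Definition computable_set (A : Ensemble nat) : Prop :=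
  exists f, computable f /\
    forall x, (In nat A x /\ f x = 1) \/ (~ In nat A x /\ f x = 0).

Fixpoint Sigma0 (n : nat) (A : Ensemble nat) : Prop :=
  match n with
  | 0 => computable_set A
  | S k => exists R : Ensemble nat,
      Pi0 k R /\ forall x, In nat A x <-> exists y, In nat R <<x, y>>
  end
with Pi0 (n : nat) (A : Ensemble nat) : Prop :=
  match n with
  | 0 => computable_set A
  | S k => exists R : Ensemble nat,
      Sigma0 k R /\ forall x, In nat A x <-> forall y, In nat R <<x, y>>
  end.

Definition arithmetic (A : Ensemble nat) : Prop := exists n, Sigma0 n A.

Definition coinfinite (A : Ensemble nat) : Prop :=
  ~ Finite nat (Complement nat A).

(** * Equivalence relations on the natural numbers *)

Definition id_rel (m n : nat) : Prop := m = n.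

Definition collapse (A : Ensemble nat) (m n : nat) : Prop :=
  m = n \/ (In nat A m /\ In nat A n).

Definition eq_class (E : nat -> nat -> Prop) (x : nat) : Ensemble nat :=
  fun z => E x z.

(** The set of [E]-classes of the values of [phi e].  Equality of sets is
    [Same_set], both for the classes and for the sets of classes. *)
Definition value_classes (E : nat -> nat -> Prop) (e : nat) :
    Ensemble (Ensemble nat) :=
  fun C => exists n y, phi e n y /\ Same_set nat C (eq_class E y).

Definition FS_jump (E : nat -> nat -> Prop) (e e' : nat) : Prop :=
  Same_set (Ensemble nat) (value_classes E e) (value_classes E e').

Definition reducible (E F : nat -> nat -> Prop) : Prop :=
  exists f : nat -> nat,
    computable f /\ forall x y, E x y <-> F (f x) (f y).

(* Main.v *)
(** Write [W_i] for the range of [phi i].  The complement of [A] is a sparse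
    cohesive set [{z_k : k}].  Along a branch of the tree of membership
    patterns [(z in W_0, z in W_1, ...)] that are realised infinitely often,
    [z_k] is the least [z >= k] that agrees with the branch on the finitely many
    indices [phi e n] with [e <= k] and [n <= 2 ^ (k + 2)].  If [phi k] is
    total, then for [n <= 2 ^ (k + 2)] the set [W_(phi k n)] contains all or none
    of [z_k, z_(k+1), ...], so its class modulo [A] is determined by [k + 2] bits:
    which of [z_0, ..., z_(k-1)] it contains, the value of the branch at its
    index, and whether it meets [A].  By the pigeonhole principle two of these
    sets are equivalent, so [phi k] does not reduce the identity.

    For the arithmetical definition of [A], [phi] is defined by the existence
    of a finite set of triples [(e, x, y)] each of which follows from others in
    the set by one evaluation step. *)

Require Import Defs.
From Stdlib Require Import Ensembles.
From Stdlib Require Import Finite_sets Arith Cantor Lia Classical List.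

(** * Computable functions *)

Definition left (x : nat) : nat := fst (Cantor.of_nat x).
Definition right (x : nat) : nat := snd (Cantor.of_nat x).

Lemma left_pair a b : left <<a, b>> = a.
Proof. unfold left. now rewrite Cantor.cancel_of_to. Qed.

Lemma right_pair a b : right <<a, b>> = b.
Proof. unfold right. now rewrite Cantor.cancel_of_to. Qed.

Lemma pair_eta x : <<left x, right x>> = x.
Proof.
  unfold left, right. rewrite <- surjective_pairing. apply Cantor.cancel_to_of.
Qed.

Lemma pair_inj a b a' b' : <<a, b>> = <<a', b'>> -> a = a' /\ b = b'.
Proof. intros H. apply Cantor.to_nat_inj in H. now inversion H. Qed.

(** As [encode] is a bijection, programs can stand in for their numbers, and closure properties
    reduce to exhibiting a program. *)
Lemma computable_iff_code f : computable f <-> exists c, forall x, eval c x (f x).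
Proof.
  split.
  - intros [e He]. destruct (encode_surj e) as [c Hc]. exists c. intros x.
    destruct (He x) as (d & Hd & Hx).
    now replace c with d by (apply encode_inj; congruence).
  - intros [c Hc]. exists (encode c). intros x. now exists c.
Qed.

Lemma computable_ext f g : (forall x, f x = g x) -> computable f -> computable g.
Proof. intros E [e He]. exists e. intros x. rewrite <- E. apply He. Qed.

Lemma computable_comp f g :
  computable f -> computable g -> computable (fun x => f (g x)).
Proof.
  rewrite !computable_iff_code. intros [c Hc] [d Hd].
  exists (ccomp c d). intros x. simpl. eauto.
Qed.

Lemma computable_id : computable (fun x => x).
Proof.
  apply computable_iff_code. exists (cpair cleft cright). intros x. simpl.
  do 2 eexists. do 2 (split; [reflexivity |]). symmetry. apply pair_eta.
Qed.

Lemma computable_S f : computable f -> computable (fun x => S (f x)).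
Proof.
  apply computable_comp, computable_iff_code. now exists csucc.
Qed.

Lemma computable_left f : computable f -> computable (fun x => left (f x)).
Proof.
  apply computable_comp, computable_iff_code. now exists cleft.
Qed.

Lemma computable_right f : computable f -> computable (fun x => right (f x)).
Proof.
  apply computable_comp, computable_iff_code. now exists cright.
Qed.

Lemma computable_const n : computable (fun _ => n).
Proof.
  induction n as [|n IH]; [| now apply computable_S].
  apply computable_iff_code. now exists czero.
Qed.

Lemma computable_pair f g :
  computable f -> computable g -> computable (fun x => <<f x, g x>>).
Proof.
  rewrite !computable_iff_code. intros [c Hc] [d Hd].
  exists (cpair c d). intros x. simpl. eauto 6.
Qed.

(** Only the recursion equations of [h] are required, so library functions such as [pred] and
    [Nat.sub] qualify as they are. *)
Lemma computable_prec (h : nat -> nat -> nat) (F G : nat -> nat) a n :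
  (forall a, h a 0 = F a) ->
  (forall a m, h a (S m) = G <<a, <<m, h a m>>>>) ->
  computable F -> computable G -> computable a -> computable n ->
  computable (fun x => h (a x) (n x)).
Proof.
  intros H0 HS HF HG Ha Hn.
  apply (computable_ext (fun x =>
    (fun w => h (left w) (right w)) <<a x, n x>>)).
  { intros x. now rewrite left_pair, right_pair. }
  apply (computable_comp (fun w => h (left w) (right w)));
    [| now apply computable_pair].
  revert HF HG. rewrite !computable_iff_code. intros [c Hc] [d Hd].
  exists (cprec c d). intros x. simpl. unfold left, right.
  destruct (Cantor.of_nat x) as [u m]. simpl.
  induction m as [|m IH]; simpl.
  - now rewrite H0.
  - exists (h u m). split; [exact IH |]. rewrite HS. apply Hd.
Qed.

Create HintDb computable.

Ltac comp :=
  lazymatch goal with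
  | |- computable (fun x => x) => exact computable_id
  | |- computable (fun _ => ?c) => exact (computable_const c)
  | |- computable S => exact (computable_S _ computable_id)
  | |- computable left => exact (computable_left _ computable_id)
  | |- computable right => exact (computable_right _ computable_id)
  | |- computable (fun x => S (@?f x)) => apply computable_S; comp
  | |- computable (fun x => left (@?f x)) => apply computable_left; comp
  | |- computable (fun x => right (@?f x)) => apply computable_right; comp
  | |- computable (fun x => Cantor.to_nat (@?f x, @?g x)) =>
      apply computable_pair; comp
  | H : computable ?f |- computable ?f => exact H
  | |- computable _ =>
      match goal with
      | H : computable ?f |- computable (fun x => ?f (@?g x)) =>
          refine (computable_comp f g H _); comp
      | _ => solve [auto with computable]
      end
  end.

Lemma computable_pred f : computable f -> computable (fun x => pred (f x)).
Proof.
  intros Hf.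
  (* Here [w] codes [<<a, <<m, h a m>>>>], so [left (right w)] is [m]; the parameter [a] is a dummy
     [0]. *)
  apply (computable_prec (fun _ n => pred n) (fun _ => 0)
    (fun w => left (right w)) (fun _ => 0) f); try comp; [reflexivity |].
  intros a m. now rewrite right_pair, left_pair.
Qed.

Lemma computable_sub f g :
  computable f -> computable g -> computable (fun x => f x - g x).
Proof.
  intros Hf Hg.
  apply (computable_prec Nat.sub (fun a => a)
    (fun w => pred (right (right w))) f g); try comp.
  - intros a. lia.
  - intros a m. rewrite !right_pair. lia.
  - apply computable_pred. comp.
Qed.

Lemma computable_double f : computable f -> computable (fun x => 2 * f x).
Proof.
  intros Hf.
  apply (computable_prec (fun _ n => 2 * n) (fun _ => 0)
    (fun w => S (S (right (right w)))) (fun _ => 0) f); try comp; [reflexivity |].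
  intros a m. rewrite !right_pair. lia.
Qed.

Lemma computable_pow2 f : computable f -> computable (fun x => 2 ^ f x).
Proof.
  intros Hf.
  apply (computable_prec (fun _ n => 2 ^ n) (fun _ => 1)
    (fun w => 2 * right (right w)) (fun _ => 0) f); try comp; [reflexivity | |].
  - intros a m. now rewrite !right_pair, Nat.pow_succ_r'.
  - apply computable_double. comp.
Qed.

(** The Goedel numbers of compound programs have this shape, [k] being the tag of the
    constructor. *)
Lemma computable_affine k f : computable f -> computable (fun x => k + 4 * f x).
Proof.
  intros Hf. induction k as [|k IH]; [| now apply computable_S].
  apply (computable_ext (fun x => 2 * (2 * f x))); [intros; lia |].
  now apply computable_double, computable_double.
Qed.

#[local] Hint Extern 1 (computable _) => apply computable_pow2; comp : computable.
#[local] Hint Extern 2 (computable _) => apply computable_affine; comp : computable.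

(** * Closure properties of the arithmetical sets *)

Lemma computable_set_compl A :
  computable_set A -> computable_set (fun x => ~ A x).
Proof.
  intros (f & Hf & HA). exists (fun x => 1 - f x). split.
  - apply computable_sub; comp.
  - unfold Ensembles.In in *. intros x.
    destruct (HA x) as [[Hx ->] | [Hx ->]]; [right | left]; split; tauto || lia.
Qed.

Lemma computable_set_and A B :
  computable_set A -> computable_set B -> computable_set (fun x => A x /\ B x).
Proof.
  intros (f & Hf & HA) (g & Hg & HB).
  exists (fun x => f x - (1 - g x)). split.
  - apply computable_sub; [| apply computable_sub]; comp.
  - unfold Ensembles.In in *. intros x.
    destruct (HA x) as [[Hx ->] | [Hx ->]], (HB x) as [[Hx' ->] | [Hx' ->]];
      [left | right | right | right]; split; tauto || lia.
Qed.

Lemma hierarchy_ext n A B :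
  (forall x, A x <-> B x) -> (Sigma0 n A -> Sigma0 n B) /\ (Pi0 n A -> Pi0 n B).
Proof.
  intros E. destruct n as [|n]; simpl; unfold Ensembles.In.
  - assert (computable_set A -> computable_set B); [| tauto].
    intros (f & Hf & HA). exists f. split; [exact Hf |].
    unfold Ensembles.In in *. intros x. specialize (E x). specialize (HA x). tauto.
  - split; intros (R & HR & HA); exists R; split; auto;
      intros x; rewrite <- E; apply HA.
Qed.

Lemma hierarchy_preimage n A f : computable f ->
  (Sigma0 n A -> Sigma0 n (fun x => A (f x))) /\
  (Pi0 n A -> Pi0 n (fun x => A (f x))).
Proof.
  revert A f. induction n as [|n IH]; intros A f Hf; simpl; unfold Ensembles.In.
  - assert (computable_set A -> computable_set (fun x => A (f x))); [| tauto].
    intros (g & Hg & HA). exists (fun x => g (f x)). split; [comp |].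
    intros x. apply HA.
  - assert (Hh : computable (fun w => <<f (left w), right w>>)) by comp.
    split; intros (R & HR & HA);
      exists (fun w => R <<f (left w), right w>>);
      (split; [apply (IH R _ Hh), HR |]); intros x; rewrite HA;
      setoid_rewrite left_pair; setoid_rewrite right_pair; reflexivity.
Qed.

Lemma hierarchy_compl n A :
  (Sigma0 n A -> Pi0 n (fun x => ~ A x)) /\
  (Pi0 n A -> Sigma0 n (fun x => ~ A x)).
Proof.
  revert A. induction n as [|n IH]; intros A; simpl; unfold Ensembles.In.
  - split; apply computable_set_compl.
  - split; intros (R & HR & HA); exists (fun w => ~ R w);
      (split; [apply (IH R), HR |]); intros x; rewrite HA.
    + firstorder.
    + split; [| firstorder]. apply not_all_ex_not.
Qed.

(** Two existential witnesses merge into one coded pair; a universal quantifier is shared by both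
    conjuncts. *)
Lemma hierarchy_and n A B :
  (Sigma0 n A -> Sigma0 n B -> Sigma0 n (fun x => A x /\ B x)) /\
  (Pi0 n A -> Pi0 n B -> Pi0 n (fun x => A x /\ B x)).
Proof.
  revert A B. induction n as [|n IH]; intros A B; simpl; unfold Ensembles.In.
  - split; apply computable_set_and.
  - split; intros (R & HR & HA) (Q & HQ & HB).
    + exists (fun w => R <<left w, left (right w)>> /\
                       Q <<left w, right (right w)>>). split.
      * apply (IH (fun w => R <<left w, left (right w)>>)
                  (fun w => Q <<left w, right (right w)>>));
          apply hierarchy_preimage with (f := fun w => <<_, _>>);
          comp || assumption.
      * intros x. rewrite HA, HB.
        setoid_rewrite left_pair. setoid_rewrite right_pair. split.
        -- intros [[y Hy] [z Hz]]. exists <<y, z>>.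
           now rewrite left_pair, right_pair.
        -- firstorder.
    + exists (fun w => R w /\ Q w). split; [now apply IH |].
      intros x. rewrite HA, HB. firstorder.
Qed.

(** A vacuous quantifier is added; [0] serves as its instance. *)
Lemma hierarchy_switch n A :
  (Sigma0 n A -> Pi0 (S n) A) /\ (Pi0 n A -> Sigma0 (S n) A).
Proof.
  split; intros HA; exists (fun w => A (left w));
    (split; [apply hierarchy_preimage; [comp | exact HA] |]); intros x;
    unfold Ensembles.In; setoid_rewrite left_pair; firstorder; exact 0.
Qed.

Lemma hierarchy_succ n A :
  (Sigma0 n A -> Sigma0 (S n) A) /\ (Pi0 n A -> Pi0 (S n) A).
Proof.
  revert A. induction n as [|n IH]; intros A.
  - split; intros H; apply hierarchy_switch, H.
  - split; intros (R & HR & HA); exists R; (split; [| exact HA]);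
      now apply IH.
Qed.

Lemma hierarchy_le m n A : m <= n -> Sigma0 m A -> Sigma0 n A.
Proof.
  induction 1 as [|n _ IH]; intros H; [exact H |].
  now apply hierarchy_succ, IH.
Qed.

(** * Closure of the arithmetical sets under connectives and quantifiers *)

Lemma arithmetic_ext A B :
  (forall x, A x <-> B x) -> arithmetic A -> arithmetic B.
Proof. intros E [n Hn]. exists n. now apply (hierarchy_ext n A B E). Qed.

Lemma arithmetic_not A : arithmetic A -> arithmetic (fun x => ~ A x).
Proof.
  intros [n Hn]. exists (S n). now apply hierarchy_switch, hierarchy_compl.
Qed.

Lemma arithmetic_and A B :
  arithmetic A -> arithmetic B -> arithmetic (fun x => A x /\ B x).
Proof.
  intros [n Hn] [m Hm]. exists (n + m).
  apply hierarchy_and; [apply (hierarchy_le n) | apply (hierarchy_le m)];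
    lia || assumption.
Qed.

Lemma arithmetic_or A B :
  arithmetic A -> arithmetic B -> arithmetic (fun x => A x \/ B x).
Proof.
  intros HA HB. apply (arithmetic_ext (fun x => ~ (~ A x /\ ~ B x))).
  - intros x. tauto.
  - now apply arithmetic_not, arithmetic_and; apply arithmetic_not.
Qed.

Lemma arithmetic_imp A B :
  arithmetic A -> arithmetic B -> arithmetic (fun x => A x -> B x).
Proof.
  intros HA HB. apply (arithmetic_ext (fun x => ~ A x \/ B x)).
  - intros x. tauto.
  - now apply arithmetic_or; [apply arithmetic_not |].
Qed.

(** An existential quantifier may only precede a [Pi0] set, so the [Sigma0 n] body is first raised
    to [Pi0 (S n)]; hence the level [S (S n)]. *)
Lemma arithmetic_ex (Q : nat -> nat -> Prop) :
  arithmetic (fun w => Q (left w) (right w)) ->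
  arithmetic (fun x => exists y, Q x y).
Proof.
  intros [n Hn]. exists (S (S n)), (fun w => Q (left w) (right w)). split.
  - now apply hierarchy_switch.
  - intros x. unfold Ensembles.In. now setoid_rewrite left_pair; setoid_rewrite right_pair.
Qed.

Lemma arithmetic_all (Q : nat -> nat -> Prop) :
  arithmetic (fun w => Q (left w) (right w)) ->
  arithmetic (fun x => forall y, Q x y).
Proof.
  intros H. apply (arithmetic_ext (fun x => ~ exists y, ~ Q x y)).
  - intros x. split; [| firstorder]. intros E y. apply NNPP. eauto.
  - apply arithmetic_not, arithmetic_ex, (arithmetic_not _ H).
Qed.

Lemma arithmetic_le f g :
  computable f -> computable g -> arithmetic (fun x => f x <= g x).
Proof.
  intros Hf Hg. exists 0. exists (fun x => 1 - (f x - g x)). split.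
  - apply computable_sub; [| apply computable_sub]; comp.
  - unfold Ensembles.In. intros x.
    destruct (Nat.le_gt_cases (f x) (g x)); [left | right]; lia.
Qed.

Lemma arithmetic_eq f g :
  computable f -> computable g -> arithmetic (fun x => f x = g x).
Proof.
  intros Hf Hg. apply (arithmetic_ext (fun x => f x <= g x /\ g x <= f x)).
  - intros x. lia.
  - now apply arithmetic_and; apply arithmetic_le.
Qed.

Create HintDb arithmetic.

(** Follows the syntax of the defining formula. Atoms other than equations and inequalities go to
    the hint database, where each predicate is registered once shown arithmetical. *)
Ltac arith :=
  cbv beta;
  lazymatch goal with
  | |- arithmetic (fun x => @?A x /\ @?B x) => apply arithmetic_and; arith
  | |- arithmetic (fun x => @?A x <-> @?B x) =>
      apply arithmetic_and; apply arithmetic_imp; arith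
  | |- arithmetic (fun x => @?A x \/ @?B x) => apply arithmetic_or; arith
  | |- arithmetic (fun x => ~ @?A x) => apply arithmetic_not; arith
  | |- arithmetic (fun x => exists y : nat, @?A x y) =>
      apply arithmetic_ex; arith
  | |- arithmetic (fun x => forall y : nat, @?A x y) =>
      apply arithmetic_all; arith
  | |- arithmetic (fun x => @?A x -> @?B x) => apply arithmetic_imp; arith
  | |- arithmetic (fun x => @?f x < @?g x) => unfold lt; apply arithmetic_le; comp
  | |- arithmetic (fun x => @?f x <= @?g x) => apply arithmetic_le; comp
  | |- arithmetic (fun x => @?f x = @?g x) => apply arithmetic_eq; comp
  | |- arithmetic _ => solve [auto with arithmetic]
  | |- computable _ => comp
  end.

(** * Finite sets coded by numbers *)

Fixpoint tail (t k : nat) : nat :=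
  match k with
  | 0 => t
  | S k => right (tail t k)
  end.

(** The number [t] is read as the sequence of the [left (tail t k)]. Elements are shifted by [S] so
    that [0], whose entries are all [0], codes the empty set. *)
Definition mem (z t : nat) : Prop := exists k, left (tail t k) = S z.

Fixpoint list_code (L : list nat) : nat :=
  match L with
  | nil => 0
  | x :: L => <<S x, list_code L>>
  end.

Lemma tail_succ t k : tail t (S k) = tail (right t) k.
Proof. induction k as [|k IH]; [reflexivity |]. cbn [tail] in *. now rewrite IH. Qed.

Lemma tail_0 k : tail 0 k = 0.
Proof. induction k as [|k IH]; [reflexivity |]. simpl. now rewrite IH. Qed.

Lemma mem_list_code z L : mem z (list_code L) <-> List.In z L.
Proof.
  induction L as [|x L IH]; cbn [list_code List.In].
  - split; [| easy]. intros [k Hk]. now rewrite tail_0 in Hk.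
  - rewrite <- IH. split.
    + intros [[|k] Hk].
      * left. cbn [tail] in Hk. rewrite left_pair in Hk. lia.
      * right. exists k. now rewrite tail_succ, right_pair in Hk.
    + intros [-> | [k Hk]].
      * exists 0. cbn [tail]. now rewrite left_pair.
      * exists (S k). now rewrite tail_succ, right_pair.
Qed.

Lemma arithmetic_mem f g :
  computable f -> computable g -> arithmetic (fun x => mem (f x) (g x)).
Proof.
  intros Hf Hg. unfold mem.
  assert (Ht : forall a n, computable a -> computable n ->
                 computable (fun x => tail (a x) (n x))).
  { intros a n. apply (computable_prec tail (fun a => a)
      (fun w => right (right (right w)))); try comp; [reflexivity |].
    intros u m. now rewrite !right_pair. }
  apply arithmetic_ex, arithmetic_eq; [| comp].
  apply computable_left, Ht; comp.
Qed.

#[local] Hint Extern 1 (arithmetic _) => simple apply arithmetic_mem; comp : arithmetic.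

(** Replaces an initial segment of an arbitrary predicate by a finite object, which a number can
    code and a formula can quantify over. *)
Lemma finite_comprehension (P : nat -> Prop) n :
  exists L, forall j, j < n -> List.In j L <-> P j.
Proof.
  induction n as [|n [L HL]]; [exists nil; lia |].
  assert (HL' : exists L', forall j, List.In j L' <-> List.In j L /\ j <> n).
  { exists (remove Nat.eq_dec n L). intros j. split.
    - apply in_remove.
    - intros []. now apply in_in_remove. }
  destruct HL' as [L' HL'].
  destruct (classic (P n)) as [Hn | Hn]; [exists (n :: L') | exists L'];
    intros j Hj; simpl; rewrite HL'; destruct (Nat.eq_dec j n) as [-> | Hjn];
    try tauto.
  all: specialize (HL j ltac:(lia)); intuition congruence.
Qed.

(** * The universal function is arithmetical *)

Definition triple (e x y : nat) : nat := <<e, <<x, y>>>>.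

(** One step in the evaluation of the program number [e] on [x], the outcomes
    of the earlier steps being given by [T]. *)
Definition justified (T : nat -> nat -> nat -> Prop) (e x y : nat) : Prop :=
  (e = 0 /\ y = 0) \/ (e = 1 /\ y = S x) \/
  (e = 2 /\ y = left x) \/ (e = 3 /\ y = right x) \/
  (exists f g a b, e = 4 + 4 * <<f, g>> /\ T f x a /\ T g x b /\ y = <<a, b>>) \/
  (exists f g z, e = 5 + 4 * <<f, g>> /\ T g x z /\ T f z y) \/
  (exists f g a, e = 6 + 4 * <<f, g>> /\ x = <<a, 0>> /\ T f a y) \/
  (exists f g a m z, e = 6 + 4 * <<f, g>> /\ x = <<a, S m>> /\
     T e <<a, m>> z /\ T g <<a, <<m, z>>>> y) \/
  (exists f, e = 7 + 4 * f /\ T f <<x, y>> 0 /\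
     forall z, z < y -> exists k, T f <<x, z>> (S k)).

Lemma justified_mono (T T' : nat -> nat -> nat -> Prop) e x y :
  (forall e x y, T e x y -> T' e x y) -> justified T e x y -> justified T' e x y.
Proof.
  intros H J.
  repeat (destruct J as [J | J]; [left; decompose [ex and] J; eauto 15 | right]).
  destruct J as (f & He & H0 & Hlt). exists f. repeat split; auto.
  intros z Hz. destruct (Hlt z Hz) as [k Hk]. eauto.
Qed.

Definition derivation (T : nat -> nat -> nat -> Prop) : Prop :=
  forall e x y, T e x y -> justified T e x y.

(** Termination comes from the program and the recursion argument, not from [T]: each premise
    concerns a proper subprogram or, for [cprec], a smaller recursion argument. *)
Lemma derivation_sound T c x y : derivation T -> T (encode c) x y -> eval c x y.
Proof.
  intros D. revert x y.
  induction c as [ | | | | f IHf g IHg | f IHf g IHg | f IHf g IHg | f IHf].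
  (* For [cprec] one premise concerns the program itself, which calls for an inner induction on the
     recursion argument. *)
  7: { intros x y. rewrite <- (pair_eta x). generalize (left x) (right x).
    intros a n H. cbn [eval]. rewrite Cantor.cancel_of_to.
    revert y H. induction n as [|n IHn]; intros y H; pose proof (D _ _ _ H) as J;
      cbn [encode] in J; unfold justified in J;
      decompose [ex and or] J; clear J; try (exfalso; lia);
      match goal with
        E : _ + 4 * <<encode ?f, encode ?g>> = _ + 4 * <<?u, ?v>>,
        E' : <<a, _>> = <<_, _>> |- _ =>
          destruct (pair_inj (encode f) (encode g) u v) as [<- <-]; [lia |];
          destruct (pair_inj _ _ _ _ E') as [-> En]; try discriminate En
      end.
    - cbn [primrec_graph]. auto.
    - injection En as ->. cbn [primrec_graph]. eauto. }
  all: intros x y H; pose proof (D _ _ _ H) as J; cbn [encode] in J;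
    unfold justified in J; decompose [ex and or] J; clear J; try (exfalso; lia);
    cbn [eval];
    try match goal with
      E : _ + 4 * <<encode ?f, encode ?g>> = _ + 4 * <<?u, ?v>> |- _ =>
        destruct (pair_inj (encode f) (encode g) u v) as [<- <-]; [lia |]
    end; eauto 10.
  match goal with E : 7 + _ = 7 + 4 * ?u |- _ =>
    replace u with (encode f) in * by lia end.
  split; [auto |]. intros z Hz.
  match goal with HT : forall z, z < y -> _ |- _ => destruct (HT z Hz) as [k Hk] end.
  eauto.
Qed.

(** * Finite derivations and completeness *)

Definition listed (L : list nat) (e x y : nat) : Prop := List.In (triple e x y) L.

Definition derivable (e x y : nat) : Prop :=
  exists L, derivation (listed L) /\ listed L e x y.

Lemma derivation_app L L' :
  derivation (listed L) -> derivation (listed L') -> derivation (listed (L ++ L')).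
Proof.
  intros H H' e x y Hin. unfold listed in Hin. apply in_app_or in Hin.
  destruct Hin as [Hin | Hin]; [apply H in Hin | apply H' in Hin];
    revert Hin; apply justified_mono; intros; apply in_or_app; auto.
Qed.

Lemma derivation_cons L e x y :
  derivation (listed L) -> justified (listed L) e x y -> derivable e x y.
Proof.
  intros HL J. exists (triple e x y :: L). split; [| now left].
  intros e' x' y' Hin. apply (justified_mono (listed L)); [now right |].
  destruct Hin as [E | Hin]; [| now apply HL].
  unfold triple in E. apply pair_inj in E as [<- E].
  apply pair_inj in E as [<- <-]. exact J.
Qed.

Lemma derivable_two e x y e' x' y' :
  derivable e x y -> derivable e' x' y' ->
  exists L, derivation (listed L) /\ listed L e x y /\ listed L e' x' y'.
Proof.
  intros (L & D & H) (L' & D' & H'). exists (L ++ L').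
  split; [now apply derivation_app |].
  split; apply in_or_app; auto.
Qed.

(** Minimisation has [y] premises, each with its own derivation; they are merged one at a time. *)
Lemma derivable_below e x (y : nat) :
  (forall z, z < y -> exists k, derivable e <<x, z>> (S k)) ->
  exists L, derivation (listed L) /\
    forall z, z < y -> exists k, listed L e <<x, z>> (S k).
Proof.
  induction y as [|y IH]; intros H.
  - exists nil. split; [intros ? ? ? [] | lia].
  - destruct IH as (L & D & HL); [auto |].
    destruct (H y) as (k & L' & D' & Hk); [lia |].
    exists (L ++ L'). split; [now apply derivation_app |].
    intros z Hz. destruct (Nat.eq_dec z y) as [-> | Hzy].
    + exists k. apply in_or_app. now right.
    + destruct (HL z) as [k' Hk']; [lia |]. exists k'. apply in_or_app. now left.
Qed.

(** Each rule has finitely many premises, so their derivations merge into one list, to which the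
    conclusion is added. *)
Lemma derivable_step e x y : justified derivable e x y -> derivable e x y.
Proof.
  intros J.
  assert (H : exists L, derivation (listed L) /\ justified (listed L) e x y).
  { unfold justified in J |- *.
    assert (D0 : derivation (listed nil)) by (intros ? ? ? []).
    destruct J as [J | [J | [J | [J | [J | [J | [J | [J | J]]]]]]]].
    1-4: exists nil; auto 10.
    - destruct J as (f & g & a & b & He & Ha & Hb & Hy).
      destruct (derivable_two _ _ _ _ _ _ Ha Hb) as (L & HL & Ha' & Hb').
      exists L. split; [exact HL | do 4 right; left; eauto 10].
    - destruct J as (f & g & z & He & Ha & Hb).
      destruct (derivable_two _ _ _ _ _ _ Ha Hb) as (L & HL & Ha' & Hb').
      exists L. split; [exact HL | do 5 right; left; eauto 10].
    - destruct J as (f & g & a & He & Hx & L & HL & Ha).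
      exists L. split; [exact HL | do 6 right; left; eauto 10].
    - destruct J as (f & g & a & m & z & He & Hx & Ha & Hb).
      destruct (derivable_two _ _ _ _ _ _ Ha Hb) as (L & HL & Ha' & Hb').
      exists L. split; [exact HL | do 7 right; left; eauto 12].
    - destruct J as (f & He & (L & HL & H0) & Hlt).
      destruct (derivable_below _ _ _ Hlt) as (L' & HL' & Hlt').
      exists (L ++ L'). split; [now apply derivation_app |].
      do 8 right. exists f. split; [exact He |].
      split; [now apply in_or_app; left |].
      intros z Hz. destruct (Hlt' z Hz) as [k Hk].
      exists k. now apply in_or_app; right. }
  destruct H as (L & HL & H). now apply (derivation_cons L).
Qed.

Lemma derivable_complete c x y : eval c x y -> derivable (encode c) x y.
Proof.
  revert x y.
  induction c as [ | | | | f IHf g IHg | f IHf g IHg | f IHf g IHg | f IHf];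
    intros x y H; cbn [eval] in H.
  - apply derivable_step. left. auto.
  - apply derivable_step. right; left. auto.
  - apply derivable_step. do 2 right; left. auto.
  - apply derivable_step. do 3 right; left. auto.
  - destruct H as (a & b & Ha & Hb & Hy).
    apply derivable_step. do 4 right; left. cbn [encode]. eauto 10.
  - destruct H as (z & Ha & Hb).
    apply derivable_step. do 5 right; left. cbn [encode]. eauto 10.
  - rewrite <- (pair_eta x) in H |- *. revert H.
    generalize (left x) (right x). intros a n. rewrite Cantor.cancel_of_to.
    revert y. induction n as [|n IHn]; intros y H; cbn [primrec_graph] in H.
    + apply derivable_step. do 6 right; left. cbn [encode]. eauto 10.
    + destruct H as (z & Hz & Hy).
      apply derivable_step. do 7 right; left.
      exists (encode f), (encode g), a, n, z. auto.
  - destruct H as [H0 Hlt].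
    apply derivable_step. do 8 right. exists (encode f).
    split; [reflexivity |]. split; [auto |].
    intros z Hz. destruct (Hlt z Hz) as [k Hk]. eauto.
Qed.

Lemma phi_iff e x y :
  phi e x y <->
  exists t, derivation (fun e x y => mem (triple e x y) t) /\ mem (triple e x y) t.
Proof.
  split.
  - intros (c & <- & H). destruct (derivable_complete _ _ _ H) as (L & D & HL).
    exists (list_code L). split; [| now apply mem_list_code].
    intros e' x' y' H'. apply mem_list_code in H'.
    apply (justified_mono (listed L)); [| now apply D].
    intros. now apply mem_list_code.
  - intros (t & D & H). destruct (encode_surj e) as [c <-].
    exists c. split; [reflexivity |]. apply (derivation_sound _ _ _ _ D H).
Qed.

Lemma arithmetic_phi e x y :
  computable e -> computable x -> computable y ->
  arithmetic (fun w => phi (e w) (x w) (y w)).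
Proof.
  intros He Hx Hy.
  apply (arithmetic_ext (fun w => exists t,
    (forall e x y, mem (triple e x y) t ->
       justified (fun e x y => mem (triple e x y) t) e x y) /\
    mem (triple (e w) (x w) (y w)) t)).
  { intros w. symmetry. apply phi_iff. }
  unfold justified, triple. arith.
Qed.

#[local] Hint Extern 1 (arithmetic _) => simple apply arithmetic_phi; comp : arithmetic.

(** * The construction *)

Lemma phi_fun e x y y' : phi e x y -> phi e x y' -> y = y'.
Proof.
  intros (c & Hc & H) (d & Hd & H').
  replace d with c in H' by (apply encode_inj; congruence).
  exact (eval_fun _ _ _ _ H H').
Qed.

(** Finitely many arguments give finitely many values. The bound is obtained classically, by cases
    on convergence. *)
Lemma phi_bounded k N :
  exists M, forall e n i, e < k -> n < N -> phi e n i -> i < M.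
Proof.
  induction k as [|k [M HM]]; [exists 0; lia |].
  assert (exists M', forall n i, n < N -> phi k n i -> i < M') as [M' HM'].
  { clear. induction N as [|N [M HM]]; [exists 0; lia |].
    assert (exists b, forall i, phi k N i -> i < b) as [b Hb].
    { destruct (classic (exists i, phi k N i)) as [[i Hi] | H].
      - exists (S i). intros j Hj. rewrite (phi_fun _ _ _ _ Hi Hj). lia.
      - exists 0. firstorder. }
    exists (M + b). intros n i Hn Hi.
    destruct (Nat.eq_dec n N) as [-> | Hn'].
    - specialize (Hb _ Hi). lia.
    - specialize (HM n i ltac:(lia) Hi). lia. }
  exists (M + M'). intros e n i He Hn Hi.
  destruct (Nat.eq_dec e k) as [-> | He'].
  - specialize (HM' n i Hn Hi). lia.
  - specialize (HM e n i ltac:(lia) Hn Hi). lia.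
Qed.

Definition range (i z : nat) : Prop := exists n, phi i n z.

Lemma arithmetic_range i z :
  computable i -> computable z -> arithmetic (fun w => range (i w) (z w)).
Proof. intros Hi Hz. unfold range. arith. Qed.

#[local] Hint Extern 1 (arithmetic _) => simple apply arithmetic_range; comp : arithmetic.

(** * The branch of patterns realised infinitely often *)

Definition infinite (P : nat -> Prop) : Prop := forall b, exists z, b <= z /\ P z.

Lemma infinite_split P Q :
  infinite P -> infinite (fun z => P z /\ Q z) \/ infinite (fun z => P z /\ ~ Q z).
Proof.
  intros HP. apply NNPP. intros H. apply not_or_and in H as [H H'].
  apply not_all_ex_not in H as [b Hb]. apply not_all_ex_not in H' as [b' Hb'].
  destruct (HP (b + b')) as (z & Hz & Pz).
  destruct (classic (Q z)); [apply Hb | apply Hb']; exists z; split; lia || tauto.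
Qed.

(** [pattern m z]: membership of [z] in the ranges number [i < m] follows the
    branch [limit] of the binary tree of those membership patterns that are
    realised infinitely often. *)
Fixpoint pattern (m z : nat) : Prop :=
  match m with
  | 0 => True
  | S m => pattern m z /\
           (range m z <-> infinite (fun z => pattern m z /\ range m z))
  end.

(** The bit of the branch at level [m], which [pattern (S m)] has to spell out. The branch goes to
    the side inside [range m] whenever that side is infinite. *)
Definition limit (m : nat) : Prop := infinite (fun z => pattern m z /\ range m z).

Lemma pattern_iff m z : pattern m z <-> forall i, i < m -> (range i z <-> limit i).
Proof.
  induction m as [|m IH]; simpl; [split; auto; lia |].
  rewrite IH. split.
  - intros [H Hm] i Hi. destruct (Nat.eq_dec i m) as [-> | Him]; [exact Hm |].
    apply H. lia.
  - intros H. split; [auto | apply H; lia].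
Qed.

(** If the side inside [range m] is finite, the branch takes the other side, which is then infinite
    by [infinite_split]. *)
Lemma infinite_pattern m : infinite (pattern m).
Proof.
  induction m as [|m IH]; [intros b; now exists b |].
  destruct (classic (limit m)) as [H | H].
  - intros b. destruct (H b) as (z & Hz & Pz & Rz). exists z. simpl. tauto.
  - destruct (infinite_split _ (range m) IH) as [H' | H']; [tauto |].
    intros b. destruct (H' b) as (z & Hz & Pz & Rz). exists z. simpl. tauto.
Qed.

(** Unfolding the recursion in [pattern] gives a formula whose complexity grows with [m]. Guessing
    the first [m + 1] bits of the branch as a coded set [s], and checking each bit against the
    earlier ones, gives a single formula for all [m]. *)
Lemma limit_iff m :
  limit m <->
  exists s,
    (forall j, j <= m -> (mem j s <-> forall b, exists z, b <= z /\
       (forall i, i < j -> (range i z <-> mem i s)) /\ range j z)) /\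
    mem m s.
Proof.
  split.
  - intros Hm. destruct (finite_comprehension limit (S m)) as [L HL].
    assert (HL' : forall j, j <= m -> (mem j (list_code L) <-> limit j)).
    { intros j Hj. rewrite mem_list_code. apply HL. lia. }
    exists (list_code L). split; [| now apply HL'].
    intros j Hj. rewrite HL' by exact Hj.
    split; intros H b; destruct (H b) as (z & Hz & Pz & Rz); exists z;
      (split; [exact Hz |]; split; [| exact Rz]).
    + intros i Hi. rewrite HL' by lia. revert i Hi. now apply pattern_iff.
    + apply pattern_iff. intros i Hi. rewrite <- HL' by lia. auto.
  - intros (s & Hs & Hm).
    (* The condition on bit [j] consults [s] only below [j], so strong induction shows that the
       guess is forced. *)
    assert (H : forall j, j <= m -> (mem j s <-> limit j)).
    { induction j as [j IH] using lt_wf_ind. intros Hj. rewrite Hs by exact Hj.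
      split; intros H b; destruct (H b) as (z & Hz & Pz & Rz); exists z;
        (split; [exact Hz |]; split; [| exact Rz]).
      - apply pattern_iff. intros i Hi. rewrite <- IH by lia. auto.
      - intros i Hi. rewrite IH by lia. revert i Hi. now apply pattern_iff. }
    now apply H.
Qed.

Lemma arithmetic_limit i : computable i -> arithmetic (fun w => limit (i w)).
Proof.
  intros Hi. eapply arithmetic_ext; [intros w; symmetry; apply limit_iff |].
  arith.
Qed.

#[local] Hint Extern 1 (arithmetic _) => simple apply arithmetic_limit; comp : arithmetic.

(** [2 ^ (k + 2)] is the number of classes in the pigeonhole argument of
    [theorem4p4] for the reduction [phi k]. *)
Definition follows (k z : nat) : Prop :=
  forall e n i, e <= k -> n <= 2 ^ S (S k) -> phi e n i -> (range i z <-> limit i).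

Lemma arithmetic_follows k z :
  computable k -> computable z -> arithmetic (fun w => follows (k w) (z w)).
Proof. intros Hk Hz. unfold follows. arith. Qed.

#[local] Hint Extern 1 (arithmetic _) => simple apply arithmetic_follows; comp : arithmetic.

(** The bound [k <= z] makes the chosen numbers unbounded, and minimality makes [z] unique. *)
Definition chosen (k z : nat) : Prop :=
  k <= z /\ follows k z /\ forall z', z' < z -> k <= z' -> ~ follows k z'.

Lemma chosen_exists k : exists z, chosen k z.
Proof.
  (* [M] exceeds every index that [follows k] mentions, so any [z] with [pattern M z] follows the
     branch; the successors turn [<=] into [<]. *)
  destruct (phi_bounded (S k) (S (2 ^ S (S k)))) as [M HM].
  destruct (infinite_pattern M k) as (z & Hz & Pz).
  assert (Fz : follows k z).
  { intros e n i He Hn Hi. apply (proj1 (pattern_iff M z) Pz).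
    apply (HM e n i); lia || assumption. }
  (* The descent to the least witness preserves [follows] but perhaps not the full pattern. *)
  clear Pz. induction z as [z IH] using lt_wf_ind.
  destruct (classic (exists z', z' < z /\ k <= z' /\ follows k z'))
    as [(z' & H & H' & H'') | H].
  - now apply (IH z').
  - exists z. split; [exact Hz |]. split; [exact Fz |]. firstorder.
Qed.

Lemma chosen_fun k z z' : chosen k z -> chosen k z' -> z = z'.
Proof.
  intros (Hk & Hz & Hmin) (Hk' & Hz' & Hmin').
  destruct (Nat.lt_trichotomy z z') as [H | [H | H]]; [| exact H |].
  - now destruct (Hmin' _ H).
  - now destruct (Hmin _ H).
Qed.

Definition sparse_compl : Ensemble nat := fun z => ~ exists k, chosen k z.

Lemma arithmetic_sparse_compl : arithmetic sparse_compl.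
Proof.
  unfold sparse_compl, chosen. arith.
Qed.

Lemma finite_bounded A : Finite nat A -> exists b, forall z, A z -> z < b.
Proof.
  induction 1 as [| A _ [b Hb] x _].
  - exists 0. intros z [].
  - exists (S (b + x)). intros z [z' Hz | z' []]; [specialize (Hb _ Hz) |]; lia.
Qed.

Lemma coinfinite_sparse_compl : coinfinite sparse_compl.
Proof.
  intros H. destruct (finite_bounded _ H) as [b Hb].
  destruct (chosen_exists b) as [z Hz].
  assert (z < b); [| destruct Hz; lia].
  apply Hb. intros H'. apply H'. now exists b.
Qed.

(** * Pigeonhole principle for bit vectors *)

Lemma filter_classic (P : nat -> Prop) (L : list nat) : NoDup L ->
  exists L1 L2, NoDup L1 /\ NoDup L2 /\ length L = length L1 + length L2 /\
    (forall x, List.In x L1 -> List.In x L /\ P x) /\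
    (forall x, List.In x L2 -> List.In x L /\ ~ P x).
Proof.
  induction 1 as [| x L Hx _ (L1 & L2 & N1 & N2 & E & H1 & H2)].
  - exists nil, nil. repeat split; try constructor; easy.
  - destruct (classic (P x)) as [Px | Px];
      [exists (x :: L1), L2 | exists L1, (x :: L2)]; simpl.
    + split; [constructor; firstorder |]. split; [exact N2 |]. split; [lia |].
      split; intros y Hy; [| firstorder].
      destruct Hy as [<- | Hy]; [auto | firstorder].
    + split; [exact N1 |]. split; [constructor; firstorder |]. split; [lia |].
      split; intros y Hy; [firstorder |].
      destruct Hy as [<- | Hy]; [auto | firstorder].
Qed.

(** Splitting by the last predicate leaves one part with more than [2 ^ m] elements, all agreeing on
    that predicate. *)
Lemma pigeonhole_patterns (P : nat -> nat -> Prop) m (L : list nat) :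
  NoDup L -> 2 ^ m < length L ->
  exists x y, List.In x L /\ List.In y L /\ x <> y /\
    forall j, j < m -> (P j x <-> P j y).
Proof.
  revert L. induction m as [|m IH]; intros L ND HL.
  - destruct L as [|x [|y L]]; simpl in HL; try lia.
    exists x, y. simpl. repeat split; try lia; auto.
    inversion_clear ND. firstorder.
  - destruct (filter_classic (P m) L ND) as (L1 & L2 & N1 & N2 & E & H1 & H2).
    assert (2 ^ m < length L1 \/ 2 ^ m < length L2) as [Hm | Hm]
      by (rewrite Nat.pow_succ_r' in HL; lia);
      [destruct (IH L1 N1 Hm) as (x & y & Hx & Hy & Hxy & H);
       apply H1 in Hx, Hy |
       destruct (IH L2 N2 Hm) as (x & y & Hx & Hy & Hxy & H);
       apply H2 in Hx, Hy];
      exists x, y; repeat split; try tauto;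
      (destruct (Nat.eq_dec j m) as [-> | Hj]; [tauto |]; apply H; lia).
Qed.

(** Outside [A] the classes are singletons, while [A] forms one class, of which any member is as
    good as another. *)
Lemma FS_jump_collapse A d d' :
  (forall z, ~ A z -> (range d z <-> range d' z)) ->
  ((exists z, A z /\ range d z) <-> exists z, A z /\ range d' z) ->
  FS_jump (collapse A) d d'.
Proof.
  assert (W : forall d d',
    (forall z, ~ A z -> range d z -> range d' z) ->
    ((exists z, A z /\ range d z) -> exists z, A z /\ range d' z) ->
    Included _ (value_classes (collapse A) d) (value_classes (collapse A) d')).
  { clear. intros d d' Hout Hin C (n & y & Hy & HC).
    destruct (classic (A y)) as [Ay | Ay].
    - destruct Hin as (y' & Ay' & n' & Hy'); [exists y; firstorder |].
      exists n', y'. split; [exact Hy' |].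
      assert (E : forall z, eq_class (collapse A) y z <-> eq_class (collapse A) y' z).
      { intros z. unfold eq_class, collapse, Ensembles.In.
        split; intros [<- | []]; auto. }
      destruct HC as [H H']. split; intros z Hz.
      + apply E, H, Hz.
      + apply H', E, Hz.
    - destruct (Hout y Ay) as [n' Hn']; [now exists n |]. exists n', y. auto. }
  intros Hout Hin. split; apply W; firstorder.
Qed.

Theorem theorem4p4 :
  exists A : Ensemble nat,
    arithmetic A /\ coinfinite A /\ ~ reducible id_rel (FS_jump (collapse A)).
Proof.
  exists sparse_compl. split; [exact arithmetic_sparse_compl |].
  split; [exact coinfinite_sparse_compl |].
  intros (f & [k Hk] & Hf).
  (* These are the [k + 2] bits that determine the class of [f n]: [k] early chosen numbers, the
     branch at [f n], and whether the range meets [sparse_compl]. *)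
  pose (P j n :=
    (j < k /\ exists z, chosen j z /\ range (f n) z) \/
    (j = k /\ limit (f n)) \/
    (j = S k /\ exists z, sparse_compl z /\ range (f n) z)).
  (* The candidates are [0] to [2 ^ (k + 2)], one more than there are bit vectors, and all within
     the bound in [follows k]. *)
  destruct (pigeonhole_patterns P (S (S k)) (seq 0 (S (2 ^ S (S k)))))
    as (x & y & Hx & Hy & Hxy & H).
  { apply seq_NoDup. }
  { rewrite length_seq. lia. }
  apply in_seq in Hx, Hy. apply Hxy, Hf, FS_jump_collapse.
  - intros z Hz. apply NNPP in Hz as [j Hj].
    destruct (Nat.lt_ge_cases j k) as [Hjk | Hjk].
    (* By [chosen_fun], bit [j] asks about [z] itself. *)
    + assert (E : forall n, range (f n) z <-> P j n).
      { intros n. unfold P. split.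
        - intros Hn. left. eauto.
        - intros [(_ & z' & Hz' & Hn) | [[] | []]]; [| lia | lia].
          now rewrite (chosen_fun _ _ _ Hj Hz'). }
      rewrite !E. apply H. lia.
    (* For [k <= j] the condition [follows j z] covers program [k] on all [n <= 2 ^ (k + 2)], so
       membership of [z] is the branch bit at [f n]. *)
    + assert (E : forall n, n <= 2 ^ S (S k) -> (range (f n) z <-> P k n)).
      { intros n Hn. destruct Hj as (_ & Hj & _).
        rewrite (Hj k n (f n)); [| lia | | apply Hk].
        - unfold P. split; [auto |]. intros [[] | [[] | []]]; auto; lia.
        - etransitivity; [exact Hn |]. apply Nat.pow_le_mono_r; lia. }
      rewrite !E by lia. apply H. lia.
  - assert (E : forall n,
      (exists z, sparse_compl z /\ range (f n) z) <-> P (S k) n).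
    { intros n. unfold P. split; [auto |]. intros [[] | [[] | []]]; auto; lia. }
    rewrite !E. apply H. lia.
Qed.
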